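(* Let $1\le k\le n$ and let $\mathfrak{C}$ be an $n\times k$ complex matrix generating an isometry $\mathfrak{C}:\mathbb{C}^k\to\mathbb{C}^n$, i.e. $\mathfrak{C}^*\mathfrak{C}=I_k$, with column vectors $c_1,\dots,c_k$. Let $D_{T^*}=(I_n-\mathfrak{C}\mathfrak{C}^* )^{1/2}$ be the defect operator associated to $\mathfrak{C}$. Then the coset generated by the point $\mathfrak{C}$ is represented by a unitary $n\times n$ matrix $A(n,k)$ that diagonalizes the projection $D_{T^*}$, in the form $$I_n-D_{T^*}=A(n,k)\begin{pmatrix} I_k&0\\0&0_{n-k}\end{pmatrix}A(n,k)^*=\sum_{i=1}^k c_i c_i^*=\mathfrak{C}\,\mathfrak{C}^* .$$
   Context: $^*$ denotes the conjugate transpose, $I_m$ the $m\times m$ identity matrix and $0_m$ the $m\times m$ zero matrix. For a contraction $T:\mathcal H\to\mathcal H'$ between Hilbert spaces the defect operators are $D_T=(I_{\mathcal H}-T^*T)^{1/2}$ and $D_{T^*}=(I_{\mathcal H'}-TT^* )^{1/2}$; here $T=\mathfrak{C}$, $\mathcal H=\mathbb{C}^k$, $\mathcal H'=\mathbb{C}^n$. The coset generated by the point $\mathfrak{C}$ is the element of $U(n)/U(n-k)$ (with $U(n-k)$ embedded as the matrices $\begin{pmatrix} I_k&0\\0&M\end{pmatrix}$, $M\in U(n-k)$) consisting of all unitary $n\times n$ matrices whose first $k$ columns are $c_1,\dots,c_k$; a matrix $A(n,k)$ represents it if it belongs to it. *)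

(* Defs.v *)
From HB Require Import structures.
From mathcomp Require Import all_boot all_order all_algebra.
From mathcomp Require Import spectral complex.
From mathcomp Require Import boolp classical_sets reals.

Set Implicit Arguments.
Unset Strict Implicit.
Unset Printing Implicit Defensive.

Import Order.TTheory GRing.Theory Num.Theory.

Local Open Scope ring_scope.
Local Open Scope sesquilinear_scope.
Local Open Scope classical_set_scope.

(* An m x n matrix T is read as the operator v |-> T *m v from column vectors
   of size n to column vectors of size m, so T ^t* is its Hilbert adjoint. *)

Section PsdSquareRoot.
Context {K : numClosedFieldType}.

Definition psdmx n (M : 'M[K]_n) : Prop :=
  M ^t* = M /\ forall v : 'cV[K]_n, 0 <= (v ^t* *m M *m v) 0 0.

(* M ^ (1/2) by functional calculus: the square root of each eigenvalue in a
   unitary diagonalization of M.  It is meant for psdmx M only, and then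
   it is the unique positive semidefinite square root of M (sqrtmx_psd,
   sqrtmx_sqr, sqrtmx_unique). *)
Definition sqrtmx n (M : 'M[K]_n) : 'M[K]_n :=
  invmx (spectralmx M) *m diag_mx (map_mx sqrtC (spectral_diag M))
    *m spectralmx M.

Lemma diag_form n (d : 'rV[K]_n) (v : 'cV[K]_n) :
  (v ^t* *m diag_mx d *m v) 0 0 = \sum_i d 0 i * `|v i 0| ^+ 2.
Proof.
rewrite mxE; apply: eq_bigr => i _; rewrite mul_mx_diag !mxE normCK.
by rewrite mulrC [_^* * _]mulrC mulrCA.
Qed.

Lemma psd_diag n (d : 'rV[K]_n) : (forall i, 0 <= d 0 i) -> psdmx (diag_mx d).
Proof.
move=> d0; split=> [|v]; last first.
  by rewrite diag_form sumr_ge0 // => i _; rewrite mulr_ge0 ?exprn_ge0.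
rewrite tr_diag_mx map_diag_mx; congr diag_mx; apply/rowP => i.
by rewrite mxE; apply/CrealP; rewrite ger0_real.
Qed.

Lemma psd_conj n (P M : 'M[K]_n) : psdmx M -> psdmx (P ^t* *m M *m P).
Proof.
move=> [hM pM]; split=> [|v].
  by rewrite !trmx_mul !map_mxM trmxCK hM mulmxA.
by have := pM (P *m v); rewrite trmx_mul map_mxM !mulmxA.
Qed.

Lemma psd_spectral n (M : 'M[K]_n) : psdmx M ->
  (spectralmx M) ^t* *m diag_mx (spectral_diag M) *m spectralmx M = M
  /\ forall i, 0 <= spectral_diag M 0 i.
Proof.
move=> pM; have nM : M \is normalmx by apply/normalmxP; rewrite pM.1.
have U := spectral_unitarymx M.
have E : (spectralmx M) ^t* *m diag_mx (spectral_diag M) *m spectralmx M = M.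
  by rewrite -invmx_unitary //; apply/esym/orthomx_spectralP.
split=> // i.
have F : spectralmx M *m M *m (spectralmx M) ^t* = diag_mx (spectral_diag M).
  by rewrite -[X in _ *m X *m _]E !mulmxA (unitarymxP U) mul1mx mulmxtVK.
have /psd_conj := pM => /(_ ((spectralmx M) ^t*)); rewrite trmxCK F => -[_].
move=> /(_ (delta_mx i 0)); rewrite diag_form.
rewrite (bigD1 i) //= big1 ?addr0 => [|j ji].
  by rewrite mxE !eqxx normr1 expr1n mulr1.
by rewrite mxE (negPf ji) normr0 expr0n mulr0.
Qed.

Lemma sqrtmx_psd n (M : 'M[K]_n) : psdmx M -> psdmx (sqrtmx M).
Proof.
move=> pM; rewrite /sqrtmx invmx_unitary ?spectral_unitarymx //.
apply/psd_conj/psd_diag => i; rewrite mxE sqrtC_ge0.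
by have [_] := psd_spectral pM.
Qed.

Lemma sqrtmx_sqr n (M : 'M[K]_n) : psdmx M -> sqrtmx M *m sqrtmx M = M.
Proof.
move=> pM; have U := spectral_unitarymx M; have [E _] := psd_spectral pM.
rewrite /sqrtmx invmx_unitary // !mulmxA mulmxtVK //.
rewrite -(mulmxA _ (diag_mx _) (diag_mx _)) mulmx_diag -[RHS]E.
congr (_ *m diag_mx _ *m _); apply/rowP => i.
by rewrite !mxE -expr2 sqrtCK.
Qed.

Lemma sqrtmx_unique n (M D : 'M[K]_n) :
  psdmx D -> D *m D = M -> D = sqrtmx M.
Proof.
move=> pD DM.
have pM : psdmx M.
  split=> [|v]; first by rewrite -DM trmx_mul map_mxM pD.1.
  rewrite -DM -{1}pD.1 mulmxA -map_mxM -trmx_mul -mulmxA mxE sumr_ge0 // => i _.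
  by rewrite !mxE mulrC mul_conjC_ge0.
have UP := spectral_unitarymx M; have [EP _] := psd_spectral pM.
have UQ := spectral_unitarymx D; have [EQ eQ] := psd_spectral pD.
rewrite /sqrtmx invmx_unitary //; move: UP EP UQ EQ eQ.
set P := spectralmx M; set Q := spectralmx D.
set s := spectral_diag M; set e := spectral_diag D => UP EP UQ EQ e0.
pose W := Q *m P ^t*.
have WE i j : (e 0 i ^+ 2 - s 0 j) * W i j = 0.
  have : diag_mx e *m diag_mx e *m W = W *m diag_mx s.
    have EM : Q *m M = diag_mx e *m diag_mx e *m Q.
      rewrite -DM -{1}EQ !mulmxA (unitarymxP UQ) mul1mx -{1}EQ !mulmxA.
      by rewrite mulmxtVK.
    rewrite /W mulmxA -EM -{1}EP !mulmxA.
    by rewrite mulmxtVK.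
  move/matrixP/(_ i j); rewrite mulmx_diag mul_diag_mx mul_mx_diag !mxE => h.
  by rewrite mulrBl expr2 h mulrC subrr.
have WD : diag_mx e *m W = W *m diag_mx (map_mx sqrtC s).
  apply/matrixP => i j; rewrite mul_diag_mx mul_mx_diag !mxE.
  have /eqP := WE i j; rewrite mulf_eq0 subr_eq0 => /orP[/eqP h|/eqP]; last first.
    by rewrite /W mxE => ->; rewrite mulr0 mul0r.
  by rewrite -h sqrCK // mulrC.
have UPt : P ^t* *m P = 1%:M by apply/mulmx1C/unitarymxP.
have UQt : Q ^t* *m Q = 1%:M by apply/mulmx1C/unitarymxP.
have -> : D = Q ^t* *m (diag_mx e *m W) *m P.
  by rewrite /W !mulmxA -(mulmxA _ _ P) UPt mulmx1.
by rewrite WD /W !mulmxA UQt mul1mx.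
Qed.

End PsdSquareRoot.

Section UnitaryQuotient.
Context {K : numClosedFieldType}.

(* The defect operator D_{T^*} = (I - T T^* )^(1/2). *)
Definition defect_adj n k (T : 'M[K]_(n, k)) : 'M[K]_n :=
  sqrtmx (1%:M - T *m T ^t*).

(* Restricted to unitary M this is the embedding of U(n-k) in U(n); at M = 0
   it is the projection diag(I_k, 0). *)
Definition block_I n k (hkn : (k <= n)%N) (M : 'M[K]_(n - k)) : 'M[K]_n :=
  castmx (subnKC hkn, subnKC hkn) (block_mx 1%:M 0 0 M).

Definition unitary_lcoset n k (hkn : (k <= n)%N) (A : 'M[K]_n) :
    set 'M[K]_n :=
  [set B | exists2 M : 'M[K]_(n - k), M \is unitarymx & B = A *m block_I hkn M].

Definition unitary_quotient n k (hkn : (k <= n)%N) : set (set 'M[K]_n) :=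
  [set X | exists2 A : 'M[K]_n, A \is unitarymx & X = unitary_lcoset hkn A].

Definition generated_coset n k (hkn : (k <= n)%N) (T : 'M[K]_(n, k)) :
    set 'M[K]_n :=
  [set A | A \is unitarymx /\ forall j : 'I_k, col (widen_ord hkn j) A = col j T].

End UnitaryQuotient.

(* Main.v *)
Require Import Defs.
From HB Require Import structures.
From mathcomp Require Import all_boot all_order all_algebra.
From mathcomp Require Import spectral complex.
From mathcomp Require Import boolp classical_sets reals.

Set Implicit Arguments.
Unset Strict Implicit.
Unset Printing Implicit Defensive.

Import Order.TTheory GRing.Theory Num.Theory.

Local Open Scope ring_scope.
Local Open Scope sesquilinear_scope.


(* The first k columns of A are A *m J, where J : 'M_(n, k) is pid_mx k, and
   diag(I_k, 0) = J *m J ^t*.  Hence every A in the coset, which contains the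
   completion of T by an orthonormal basis of its orthogonal complement, turns
   diag(I_k, 0) into T *m T ^t*.  Since 1 - T *m T ^t* is an orthogonal
   projection, it is its own positive semidefinite square root, i.e. D. *)

Section IsometryCoset.
Context {K : numClosedFieldType}.

(** Trades the columnwise description of the coset for one matrix equation, which can be multiplied
    and conjugated. *)
Lemma mulmx_pidP n k (hkn : (k <= n)%N) (A : 'M[K]_n) (T : 'M[K]_(n, k)) :
  (forall j : 'I_k, col (widen_ord hkn j) A = col j T) <-> A *m pid_mx k = T.
Proof.
have Acol j : col j (A *m pid_mx k) = col (widen_ord hkn j) A.
  apply/colP => i; rewrite !mxE (bigD1 (widen_ord hkn j)) //= big1 => [|l lj].
    by rewrite mxE eqxx /= ltn_ord mulr1 addr0.
  by rewrite mxE -[_ == _ :> nat]/(l == widen_ord hkn j) (negPf lj) mulr0.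
split=> [AT|<- j]; last by rewrite Acol.
by apply/matrixP => i j; have /colP/(_ i) := AT j; rewrite -Acol !mxE.
Qed.

Lemma generated_cosetP n k (hkn : (k <= n)%N) (T : 'M[K]_(n, k)) (A : 'M[K]_n) :
  generated_coset hkn T A <-> A \is unitarymx /\ A *m pid_mx k = T.
Proof.
by split=> -[UA /(mulmx_pidP hkn) AT]; split=> //; apply/(mulmx_pidP hkn).
Qed.

Lemma trmxC_mul m n p (A : 'M[K]_(m, n)) (B : 'M[K]_(n, p)) :
  (A *m B) ^t* = B ^t* *m A ^t*.
Proof. by rewrite trmx_mul map_mxM. Qed.

Lemma trmxC1 n : (1%:M : 'M[K]_n) ^t* = 1%:M.
Proof. by rewrite trmx1 map_mx1. Qed.

Lemma trmxC_pid m n r : (pid_mx r : 'M[K]_(m, n)) ^t* = pid_mx r.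
Proof. by rewrite tr_pid_mx map_pid_mx. Qed.

Lemma unitarymxPC n (A : 'M[K]_n) : A \is unitarymx -> A ^t* *m A = 1%:M.
Proof. by move/unitarymxP/mulmx1C. Qed.

Lemma pid_mx_proj n k :
  (pid_mx k : 'M[K]_(n, k)) *m (pid_mx k : 'M[K]_(k, n)) = pid_mx k.
Proof. by rewrite mul_pid_mx !minnn. Qed.

Lemma block_I0 n k (hkn : (k <= n)%N) : block_I hkn 0 = pid_mx k :> 'M[K]_n.
Proof.
(* With [n - k] generalized to [m], the equation [k + m = n] can be destructed, and the cast
   disappears. *)
rewrite /block_I; move: (n - k)%N (subnKC hkn) => m e; clear hkn.
by case: n / e; rewrite castmx_id pid_mx_block.
Qed.

Lemma block_I_pid n k (hkn : (k <= n)%N) (M : 'M[K]_(n - k)) :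
  block_I hkn M *m pid_mx k = pid_mx k :> 'M[K]_(n, k).
Proof.
rewrite /block_I; move: (n - k)%N (subnKC hkn) M => m e; clear hkn.
case: n / e => M; rewrite castmx_id pid_mx_col mul_block_col.
by rewrite !mul0mx !mul1mx mulmx0 !addr0.
Qed.

Lemma block_I_unitary n k (hkn : (k <= n)%N) (M : 'M[K]_(n - k)) :
  M \is unitarymx -> block_I hkn M \is unitarymx.
Proof.
rewrite /block_I; move: (n - k)%N (subnKC hkn) M => m e; clear hkn.
case: n / e => M /unitarymxP UM; rewrite castmx_id; apply/unitarymxP.
rewrite tr_block_mx map_block_mx mulmx_block UM !trmx0 !map_mx0 trmxC1.
by rewrite !mulmx0 !mul0mx mulmx1 !addr0 add0r -scalar_mx_block.
Qed.

(** Both [B] and its adjoint fix the first [k] basis vectors, so the two off-diagonal blocks of [B]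
    vanish. *)
Lemma unitary_fix_pid n k (hkn : (k <= n)%N) (B : 'M[K]_n) :
  B \is unitarymx -> B *m pid_mx k = pid_mx k :> 'M[K]_(n, k) ->
  exists2 M : 'M[K]_(n - k), M \is unitarymx & B = block_I hkn M.
Proof.
move=> UB BI; have BtI : B ^t* *m pid_mx k = pid_mx k :> 'M[K]_(n, k).
  by rewrite -{1}BI mulmxA unitarymxPC // mul1mx.
rewrite /block_I; move: (n - k)%N (subnKC hkn) => m e; clear hkn.
case: n / e B UB BI BtI => B; rewrite -(submxK B).
move: (ulsubmx B) (ursubmx B) (dlsubmx B) (drsubmx B) => a b c d.
move/unitarymxP => UB; rewrite tr_block_mx map_block_mx !pid_mx_col.
rewrite !mul_block_col !mulmx0 !mulmx1 !addr0.
move=> /eq_col_mx[a1 c0]; rewrite {}a1 {}c0 in UB *.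
move=> /eq_col_mx[_ /(congr1 (fun X => X ^t*))].
rewrite trmxCK trmx0 map_mx0 => b0; rewrite {}b0 in UB *.
exists d; last by rewrite castmx_id.
(* The lower right block of [B *m B ^t* = 1%:M] now says that [d] is unitary. *)
move: UB; rewrite tr_block_mx map_block_mx mulmx_block scalar_mx_block.
move=> /eq_block_mx[_ _ _]; rewrite !trmx0 !map_mx0 !mul0mx add0r.
by move=> UB; apply/unitarymxP.
Qed.

(** Gram-Schmidt on the left kernel of [T] gives the rows of [V]; their adjoints form an orthonormal
    basis of the orthogonal complement of the range of [T]. *)
Lemma orthonormal_completion n k (hkn : (k <= n)%N) (T : 'M[K]_(n, k)) :
  T ^t* *m T = 1%:M -> exists A : 'M[K]_n, generated_coset hkn T A.
Proof.
move=> hT; pose V := schmidt (row_base (kermx T)).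
have rV : \rank (kermx T) = (n - k)%N.
  rewrite mxrank_ker; suff /eqP-> : row_full T by [].
  by apply/row_fullP; exists (T ^t*).
have UV : V \is unitarymx by rewrite schmidt_unitarymx ?rank_leq_col.
have VT : V *m T = 0.
  by apply/sub_kermxP; rewrite eqmx_schmidt_free ?row_base_free ?eq_row_base.
(* [V] consists of rows, so the adjoint of the completion is built: [T ^t*] stacked on [V]. *)
suff [B UB BT] : exists2 B : 'M[K]_n, B \is unitarymx & pid_mx k *m B = T ^t*.
  exists (B ^t*); apply/generated_cosetP; split; first by rewrite trmxC_unitary.
  by rewrite -trmxC_pid -trmxC_mul BT trmxCK.
(* The row count of [V] is a rank; it is generalized so that it can be replaced by [n - k]. *)
move: (\rank _) rV V UV VT => _ -> V UV VT.
move: (n - k)%N (subnKC hkn) V UV VT => m e; clear hkn.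
case: n / e T hT => T hT V UV VT; exists (col_mx (T ^t*) V); last first.
  by rewrite pid_mx_row mul_row_col mul1mx mul0mx addr0.
apply/unitarymxP; rewrite tr_col_mx map_row_mx mul_col_row trmxCK.
rewrite hT (unitarymxP UV) VT -trmxC_mul VT trmx0 map_mx0.
by rewrite -scalar_mx_block.
Qed.

(** If [A] and [B] are unitary with the same first [k] columns, then [A ^t* *m B] is unitary and
    fixes the first [k] basis vectors, hence lies in the embedded U(n-k). *)
Lemma generated_coset_lcoset n k (hkn : (k <= n)%N) (T : 'M[K]_(n, k))
    (A : 'M[K]_n) :
  generated_coset hkn T A -> generated_coset hkn T = unitary_lcoset hkn A.
Proof.
move=> /generated_cosetP[UA AT]; apply/seteqP; split=> [B|_ [M UM ->]].
  move=> /generated_cosetP[UB BT].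
  have [||M UM AB] := @unitary_fix_pid n k hkn (A ^t* *m B).
  - by rewrite mul_unitarymx ?trmxC_unitary.
  - by rewrite -mulmxA BT -AT mulmxA unitarymxPC // mul1mx.
  by exists M => //; rewrite -AB mulmxA (unitarymxP UA) mul1mx.
apply/generated_cosetP; split; first by rewrite mul_unitarymx ?block_I_unitary.
by rewrite -mulmxA block_I_pid.
Qed.

(** Since [P = P ^t* *m P], the quadratic form at [v] is the squared norm of [P *m v]. *)
Lemma psd_proj n (P : 'M[K]_n) : P ^t* = P -> P *m P = P -> psdmx P.
Proof.
move=> hP pP; split=> // v.
rewrite -pP -{1}hP mulmxA -trmxC_mul -mulmxA mxE sumr_ge0 // => i _.
by rewrite !mxE mulrC mul_conjC_ge0.
Qed.

Lemma trmxC_compl n k (T : 'M[K]_(n, k)) :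
  (1%:M - T *m T ^t*) ^t* = 1%:M - T *m T ^t*.
Proof.
by rewrite linearB /= map_mxB trmxC_mul trmxCK trmxC1.
Qed.

Lemma isometry_compl_idem n k (T : 'M[K]_(n, k)) : T ^t* *m T = 1%:M ->
  (1%:M - T *m T ^t*) *m (1%:M - T *m T ^t*) = 1%:M - T *m T ^t*.
Proof.
move=> hT; rewrite mulmxBr mulmx1 mulmxBl mul1mx mulmxA -(mulmxA T) hT.
by rewrite mulmx1 subrr subr0.
Qed.

Lemma defect_adj_isometry n k (T : 'M[K]_(n, k)) : T ^t* *m T = 1%:M ->
  defect_adj T = 1%:M - T *m T ^t*.
Proof.
move=> hT; have pp := isometry_compl_idem hT.
by apply/esym/sqrtmx_unique => //; apply: psd_proj => //; apply: trmxC_compl.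
Qed.

Lemma generated_coset_conj n k (hkn : (k <= n)%N) (T : 'M[K]_(n, k))
    (A : 'M[K]_n) :
  generated_coset hkn T A -> A *m block_I hkn 0 *m A ^t* = T *m T ^t*.
Proof.
move=> /generated_cosetP[UA <-].
by rewrite block_I0 trmxC_mul trmxC_pid -pid_mx_proj !mulmxA.
Qed.

Lemma generated_coset_diag n k (hkn : (k <= n)%N) (T : 'M[K]_(n, k))
    (A : 'M[K]_n) :
  generated_coset hkn T A ->
  is_diag_mx (A ^t* *m (1%:M - T *m T ^t*) *m A).
Proof.
(* Conjugation by [A] reduces the matrix to [1%:M - pid_mx k]. *)
move=> AT; have [UA _] := AT; rewrite -(generated_coset_conj AT) block_I0.
rewrite mulmxBr mulmx1 mulmxBl !mulmxA unitarymxPC // mul1mx.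
rewrite -mulmxA unitarymxPC // mulmx1; apply/is_diag_mxP => i j ij.
by rewrite !mxE -val_eqE (negPf ij) subr0.
Qed.

(** Expansion of a product into rank-one terms; with [B = T ^t*] the rows are the adjoints of the
    columns of [T]. *)
Lemma sum_col_mul m k n (A : 'M[K]_(m, k)) (B : 'M[K]_(k, n)) :
  \sum_(i < k) col i A *m row i B = A *m B.
Proof.
apply/matrixP => i j; rewrite summxE !mxE; apply: eq_bigr => l _.
by rewrite !mxE big_ord1 !mxE.
Qed.

End IsometryCoset.

Theorem mainTheorem1 (R : realType) (n k : nat) (hk : (1 <= k)%N)
    (hkn : (k <= n)%N) (T : 'M[R[i]]_(n, k)) (hT : T ^t* *m T = 1%:M) :
  let D := defect_adj T in
  [/\ unitary_quotient hkn (generated_coset hkn T),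
      D ^t* = D /\ D *m D = D
    & exists A : 'M[R[i]]_n,
      [/\ A \is unitarymx,
          generated_coset hkn T A,
          is_diag_mx (A ^t* *m D *m A)
        & [/\ 1%:M - D = A *m block_I hkn 0 *m A ^t*,
              A *m block_I hkn 0 *m A ^t* =
                \sum_(i < k) col i T *m (col i T) ^t*
            & \sum_(i < k) col i T *m (col i T) ^t* = T *m T ^t*]]].
Proof.
have sumT : \sum_(i < k) col i T *m (col i T) ^t* = T *m T ^t*.
  by rewrite -sum_col_mul; apply: eq_bigr => i _; rewrite tr_col map_row.
rewrite defect_adj_isometry //=.
have [A AT] := orthonormal_completion hkn hT; have [UA _] := AT.
have AE := generated_coset_conj AT.
(* The same completion [A] shows that the set is a coset and serves as the diagonalizing
   representative. *)
split; first by exists A => //; apply: generated_coset_lcoset.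
  by split; [apply: trmxC_compl | apply: isometry_compl_idem].
exists A; split=> //; first exact: generated_coset_diag AT.
by split; rewrite ?AE ?sumT // subKr.
Qed.
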